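(* Let $X$, $Y$ be separable Banach spaces, $G \subset X$ an open set and $f: G \to Y$ an arbitrary mapping. Then there exists a $\sigma$-porous set $A \subset G$ such that, for each $x\in G\setminus A$, the following assertion holds: if $f$ is Lipschitz at $x$ and there exist a finite-dimensional subspace $V^x$ of $X$ and a topological complement $W^x$ of $V^x$ in $X$ such that $f$ is Fréchet differentiable at $x$ along $V^x$ and along $W^x$, then $f$ is Fréchet differentiable at $x$.
   Context: All Banach spaces are real and nontrivial ($\neq\{0\}$), with norm denoted $|\cdot|$. A subspace of a Banach space means a closed linear subspace $\neq\{0\}$. A topological complement of $V$ in $X$ is a subspace $W$ such that $X$ is the topological direct sum $V\oplus W$. $B(x,r)$ is the open ball. For a subspace $V$ of $X$, $f$ is Fréchet differentiable at $x\in G$ along $V$ if the mapping $g(v):=f(x+v)$, $v\in V\cap(G-x)$, is Fréchet differentiable at $0\in V$. $f$ is Lipschitz at $x\in G$ if $\limsup_{y\to x}\frac{|f(y)-f(x)|}{|y-x|}<\infty$. A set $A\subset X$ is porous at $x\in X$ if there exists $c>0$ such that for each $\delta>0$ there exists $t\in B(x,\delta)\setminus\{x\}$ with $B(t,c|t-x|)\cap A=\emptyset$. $A$ is porous if it is porous at each of its points, and $\sigma$-porous if it is a countable union of porous sets. *)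

(* Defs.v *)
From HB Require Import structures.
From mathcomp Require Import all_boot all_order all_algebra.
From mathcomp Require Import all_classical all_reals all_analysis.

Set Implicit Arguments.
Unset Strict Implicit.
Unset Printing Implicit Defensive.

Import Order.TTheory GRing.Theory Num.Theory.
Import numFieldNormedType.Exports.

Local Open Scope classical_set_scope.
Local Open Scope ring_scope.

Section LinearSubspaces.
Context {R : realType} {X : normedModType R}.

(* The normed space carried by a linear subspace V of X: the norm is the
   restriction of that of X and the topology is the one induced by this norm.
   The topology that [set_type] gets by default is not attached to an algebraic
   structure, hence a separate type constant. *)
Definition subsp (V : submodClosed X) := {v : X | v \in V}.

Section SubspNormed.
Variable V : submodClosed X.

HB.instance Definition _ := SubType.on (subsp V).
HB.instance Definition _ := [Choice of subsp V by <:].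
HB.instance Definition _ := [SubChoice_isSubLmodule of subsp V by <:].

Let subsp_norm (v : subsp V) : R := `|\val v|.

Let subsp_ler_normD u v : subsp_norm (u + v) <= subsp_norm u + subsp_norm v.
Proof. exact: ler_normD. Qed.

Let subsp_normrZ (a : R) v : subsp_norm (a *: v) = `|a| * subsp_norm v.
Proof. exact: normrZ. Qed.

Let subsp_normr0_eq0 v : subsp_norm v = 0 -> v = 0.
Proof. by move=> /normr0_eq0 v0; exact/val_inj. Qed.

HB.instance Definition _ := Lmodule_isNormed.Build R (subsp V)
  subsp_ler_normD subsp_normrZ subsp_normr0_eq0.

End SubspNormed.

Definition banach_subspace (V : submodClosed X) :=
  closed [set` V] /\ exists2 v, v \in V & v != 0.

Definition finite_dimensional (V : submodClosed X) :=
  exists (n : nat) (e : 'I_n -> X), (forall i, e i \in V) /\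
    forall v, v \in V -> exists a : 'I_n -> R, v = \sum_(i < n) a i *: e i.

Definition subsp_add (V W : submodClosed X) (p : subsp V * subsp W) : X :=
  \val p.1 + \val p.2.

(* X is the topological direct sum of V and W when (v, w) |-> v + w is a
   homeomorphism from V * W onto X. *)
Definition topological_direct_sum (V W : submodClosed X) :=
  continuous (@subsp_add V W) /\
  exists h : X -> subsp V * subsp W,
    [/\ cancel (@subsp_add V W) h, cancel h (@subsp_add V W) & continuous h].

Definition topological_complement (V W : submodClosed X) :=
  banach_subspace W /\ topological_direct_sum V W.

End LinearSubspaces.

(* Mappings defined on an open set G are represented by total functions: the
   two notions below depend only on the values of f near x. *)
Section PointwiseNotions.
Context {R : realType} {X Y : normedModType R}.

Definition differentiable_along (f : X -> Y) (x : X) (V : submodClosed X) :=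
  differentiable (fun v : subsp V => f (x + \val v)) (0 : subsp V).

Definition lipschitz_at (f : X -> Y) (x : X) : Prop :=
  (limf_esup (fun y => (`|f y - f x| / `|y - x|)%:E) x^' < +oo)%E.

End PointwiseNotions.

Section Porosity.
Context {R : realType} {X : normedModType R}.

Definition porous_at (A : set X) (x : X) :=
  exists2 c : R, 0 < c & forall d : R, 0 < d ->
    exists t : X, [/\ ball x d t, t != x & ball t (c * `|t - x|) `&` A = set0].

Definition porous (A : set X) := forall x, A x -> porous_at A x.

Definition sigma_porous (A : set X) :=
  exists P : nat -> set X, (forall n, porous (P n)) /\ A = \bigcup_n P n.

End Porosity.

Definition separable (T : topologicalType) :=
  exists D : set T, countable D /\ dense D.

(* Main.v *)
(* At an exceptional point x let L be the linear map glued from the two partial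
   derivatives; there is eps > 0 such that
   |f y - f x - L (y - x)| > eps |y - x| for points y arbitrarily close to x.
   Sort the exceptional points into countably many pieces according to
   approximate values of a basis e_i of V^x and of the derivatives L e_i, and to
   uniform constants for the Lipschitz property and for the differentiability
   along V^x.  Suppose that x' lies in the piece of x, very close to y relative
   to |y - x|.  As V^x' is close to V^x, also X = V^x' + W^x, so that
   x' - x = v' + w with v' in V^x' and w in W^x.  Then
   f x' ~ f (x' - v') + L' v' = f (x + w) + L' v' ~ f x + L w + L' v'
        ~ f x + L (y - x),
   by differentiability of f at x' along V^x' and at x along W^x, while
   f y ~ f x' by the Lipschitz property at x': a contradiction.  Hence the piece
   misses a ball around y of radius proportional to |y - x|.  No uniformity is
   needed for W^x; finite dimension of V^x and separability are used to have
   countably many approximate bases. *)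
Require Import Defs.
From HB Require Import structures.
From mathcomp Require Import all_boot all_order all_algebra.
From mathcomp Require Import all_classical all_reals all_analysis.
From mathcomp Require Import lra.

Set Implicit Arguments.
Unset Strict Implicit.
Unset Printing Implicit Defensive.

Import Order.TTheory GRing.Theory Num.Theory.
Import numFieldNormedType.Exports.

Local Open Scope classical_set_scope.
Local Open Scope ring_scope.

(** * Small linear perturbations of the identity *)

Lemma solve_half_perturbation (R : realType) (X : completeNormedModType R)
    (S : {linear X -> X}) (hS : forall z, `|S z| <= 2^-1 * `|z|) (u : X) :
  exists z, z + S z = u.
Proof.
(* Solutions are the fixed points of this contraction of ratio 1/2; completeness of [X] enters
   here. *)
pose g (z : X) := u - S z.
have gfun : set_fun setT setT g by [].
pose G : {fun [set: X] >-> [set: X]} :=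
  HB.pack g (isFun.Build X X setT setT g gfun).
have Gc : is_contraction G.
  have q0 : 0 <= 2^-1 :> R by rewrite invr_ge0.
  exists (NngNum q0); split => /=; first by rewrite invf_lt1 ?ltr1n.
  move=> [z1 z2] _ /=; rewrite /g.
  have -> : u - S z1 - (u - S z2) = S (z2 - z1).
    by rewrite [RHS]linearB opprB addrC addrA subrK.
  by rewrite (distrC z1); exact: hS.
have [z _ ze] := banach_fixed_point Gc closedT (ex_intro _ 0 I).
by exists z; rewrite {1}ze /= /g subrK.
Qed.

Lemma norm_sum_scale_le (R : realType) (X : normedModType R) (m : nat)
    (c : 'I_m -> R) (g : 'I_m -> X) (k th : R) :
  (forall i, `|c i| <= k) -> (forall i, `|g i| <= th) ->
  `|\sum_i c i *: g i| <= m%:R * (k * th).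
Proof.
move=> hc hg; apply: (le_trans (ler_norm_sum _ _ _)).
have -> : m%:R * (k * th) = \sum_(i < m) (k * th).
  by rewrite sumr_const card_ord mulr_natl.
by apply: ler_sum => i _; rewrite normrZ ler_pM.
Qed.

(** The perturbation z |-> \sum_i a_i(z) g_i has norm at most m K th <= 1/2. With g_i = e'_i - e_i
    this makes the span of the e'_i and the old complement still fill X. *)
Lemma perturbed_decomposition (R : realType) (X : completeNormedModType R)
    (m : nat) (a : 'I_m -> {linear X -> R^o})
    (K th : R) (g : 'I_m -> X) (u : X) :
  (forall i z, `|a i z| <= K * `|z|) -> (forall i, `|g i| <= th) ->
  m%:R * (K * th) <= 2^-1 ->
  exists z, [/\ z + \sum_i a i z *: g i = u,
    `|z - u| <= m%:R * (K * th) * `|z| & `|z| <= 2 * `|u|].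
Proof.
move=> ha hg hK.
pose S z := \sum_i a i z *: g i.
have Slin : linear S.
  move=> k v w; rewrite /S scaler_sumr -big_split; apply: eq_bigr => i _ /=.
  by rewrite linearP scalerDl scalerA.
have Sle z : `|S z| <= m%:R * (K * th) * `|z|.
  rewrite -mulrA -[_ * th * _]mulrA [th * _]mulrC [K * _]mulrA.
  exact: norm_sum_scale_le.
pose S' : {linear X -> X} := HB.pack S (GRing.isLinear.Build _ _ _ _ S Slin).
have [|z ze] := @solve_half_perturbation _ _ S' _ u.
  by move=> z; apply: (le_trans (Sle z)); rewrite ler_wpM2r.
have zu : z - u = - S z by rewrite -ze /= opprD addNKr.
exists z; split => //; first by rewrite zu normrN.
have := ler_normB z (z - u); rewrite opprB addrCA subrr addr0.
have : `|z - u| <= 2^-1 * `|z|.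
  by rewrite zu normrN (le_trans (Sle z)) // ler_wpM2r.
have := ler_normD u (z - u); rewrite addrCA subrr addr0.
by lra.
Qed.

(** * Comparing increments at two nearby base points *)

Definition approx_on {R : realType} {X Y : normedModType R} (f : X -> Y) (x : X)
    (L : X -> Y) (S : set X) (eta d : R) :=
  forall h, S h -> `|h| < d -> `|f (x + h) - f x - L h| <= eta * `|h|.

(* For z with z + \sum_i a_i(z) (e'_i - e_i) = x' - x, put
   v' = \sum_i a_i(z) e'_i and w = z - \sum_i a_i(z) e_i; then
   x' - v' = x + w. *)
Lemma increment_estimate (R : realType) (X : completeNormedModType R)
    (Y : normedModType R) (f : X -> Y) (m : nat) (x x' y : X) (e e' : 'I_m -> X)
    (a : 'I_m -> {linear X -> R^o}) (L L' : {linear X -> Y})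
    (K M E N c eta dV dW dL r : R) :
  0 <= K -> 0 <= M -> 0 <= E -> 0 <= N -> 0 < eta -> 0 <= c <= 1 -> 0 < r ->
  (forall i z, `|a i z| <= K * `|z|) -> (forall z, `|L z| <= M * `|z|) ->
  (forall i, `|e i| <= E) ->
  (forall i, `|e' i - e i| <= 2 * eta) ->
  (forall i, `|L' (e' i) - L (e i)| <= 2 * eta) ->
  m%:R * (K * (2 * eta)) <= 2^-1 ->
  approx_on f x' L' (range (fun v : 'I_m -> R => \sum_i v i *: e' i)) eta dV ->
  approx_on f x L (range (fun z => z - \sum_i a i z *: e i)) eta dW ->
  (forall z, `|z - x'| < dL -> `|f z - f x'| <= N * `|z - x'|) ->
  `|y - x| <= r -> `|y - x'| <= c * r ->
  r < dL -> 6 * (1 + m%:R * K * E) * r < dV ->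
  4 * (1 + m%:R * K * E) * r < dW ->
  `|f y - f x - L (y - x)| <= ((N + M) * c +
     eta * (10 * (1 + m%:R * K * E) + 8 * (m%:R * K) + 8 * (m%:R * K * M))) * r.
Proof.
move=> K0 M0 E0 N0 eta0 /andP[c0 c1] r0 ha hL he hee hbb small hV hW hLip.
move=> yx yx' rL rV rW.
set H := 1 + m%:R * K * E in rV rW *.
have mK0 : 0 <= m%:R * K by rewrite mulr_ge0.
have H1 : 1 <= H by rewrite lerDl mulr_ge0.
set u := x' - x.
have ur : `|u| <= 2 * r.
  have -> : u = (y - x) - (y - x') by rewrite /u opprB [RHS]addrC addrA subrK.
  have := ler_normB (y - x) (y - x').
  have : c * r <= r by rewrite ler_piMl // ltW.
  lra.
have [z [zu zu1 zu2]] := perturbed_decomposition u ha hee small.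
have zr : `|z| <= 4 * r by lra.
set P := \sum_i a i z *: e i.
set v' := \sum_i a i z *: e' i.
set w := z - P.
have wv : w + v' = u.
  rewrite /w /v' /P -zu -addrA; congr (_ + _).
  by rewrite addrC -sumrB; apply: eq_bigr => i _; rewrite scalerBr.
(* [H] bounds the norm of z |-> z - \sum_i a_i(z) e_i. *)
have wH : `|w| <= H * (4 * r).
  apply: (@le_trans _ _ (H * `|z|)); last first.
    by rewrite ler_wpM2l // (le_trans _ H1).
  apply: (le_trans (ler_normB _ _)); rewrite /H mulrDl mul1r lerD2l.
  rewrite -mulrA -[_ * K * _]mulrA [E * _]mulrC [K * _]mulrA.
  by apply: norm_sum_scale_le => i; rewrite ?ha.
have rH : r <= H * r by rewrite ler_peMl // ltW.
(* 6 H r comes from |u| + |w| <= 2 r + 4 H r and H >= 1. *)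
have v'H : `|v'| <= 6 * H * r.
  have -> : v' = u - w by rewrite -wv [w + _]addrC addrK.
  have := ler_normB u w; lra.
have t1 : `|f y - f x'| <= N * (c * r).
  apply: (le_trans (hLip _ _)); last by rewrite ler_wpM2l.
  by apply: le_lt_trans rL; apply: (le_trans yx'); rewrite ler_piMl // ltW.
have t2 : `|f (x' - v') + L' v' - f x'| <= eta * (6 * H * r).
  have v'range : range (fun v : 'I_m -> R => \sum_i v i *: e' i) (- v').
    exists (fun i => - a i z) => //.
    by rewrite /v' -sumrN; apply: eq_bigr => i _; rewrite scaleNr.
  have := hV _ v'range; rewrite normrN linearN opprK addrAC.
  move=> /(_ (le_lt_trans v'H rV)) /le_trans; apply.
  by rewrite ler_wpM2l // ltW.
have t3 : `|f (x + w) - f x - L w| <= eta * (H * (4 * r)).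
  have wrange : range (fun z => z - \sum_i a i z *: e i) w by exists z.
  have := hW _ wrange; move=> /(_ _) /le_trans; apply.
    by apply: le_lt_trans rW; rewrite (le_trans wH) // mulrCA mulrA.
  by rewrite ler_wpM2l // ltW.
have xw : x' - v' = x + w.
  by apply/eqP; rewrite subr_eq -addrA wv /u addrCA subrr addr0.
(* Both sums have the same coefficients a_i(z), so closeness of L' e'_i to L e_i suffices. *)
have t4 : `|L' v' - L P| <= 8 * (m%:R * K) * eta * r.
  have -> : L' v' - L P = \sum_i a i z *: (L' (e' i) - L (e i)).
    rewrite /v' /P (linear_sum L') (linear_sum L) -[LHS]sumrB.
    by apply: eq_bigr => i _; rewrite scalerBr (linearZZ L') (linearZZ L).
  have h : forall i, `|a i z| <= K * (4 * r).
    by move=> i; rewrite (le_trans (ha i z)) // ler_wpM2l.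
  apply: (le_trans (norm_sum_scale_le h hbb)).
  by lra.
have t5 : `|L (z - u)| <= M * (8 * (m%:R * K) * eta * r).
  apply: (le_trans (hL _)); rewrite ler_wpM2l // (le_trans zu1) //.
  apply: (@le_trans _ _ (m%:R * (K * (2 * eta)) * (4 * r))).
    by rewrite ler_wpM2l // !mulr_ge0 // ltW.
  by lra.
have t6 : `|L (y - x')| <= M * (c * r).
  by apply: (le_trans (hL _)); rewrite ler_wpM2l.
(* The intermediate points are f x', f (x' - v') + L' v' = f (x + w) + L' v', f x + L w + L' v', f x
   + L z and f x + L u. *)
have dec : `|f y - f x - L (y - x)| <= `|f y - f x'|
    + `|f (x' - v') + L' v' - f x'| + `|f (x + w) - f x - L w|
    + `|L' v' - L P| + `|L (z - u)| + `|L (y - x')|.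
  rewrite -addrA -opprD.
  apply: (le_trans (ler_distD (f x + L u) _ _)); apply: lerD; last first.
    have -> : y - x' = (y - x) - u by rewrite /u opprB addrA subrK.
    by rewrite (linearB L (y - x)) opprD addrACA subrr add0r distrC.
  apply: (le_trans (ler_distD (f x + L z) _ _)); apply: lerD; last first.
    by rewrite opprD addrACA subrr add0r (linearB L z).
  apply: (le_trans (ler_distD (f x + L w + L' v') _ _)).
  apply: lerD; last first.
    have -> : L z = L w + L P by rewrite -linearD subrK.
    by rewrite addrA opprD addrACA subrr add0r.
  apply: (le_trans (ler_distD (f (x' - v') + L' v') _ _)).
  apply: lerD; last first.
    by rewrite opprD addrACA subrr addr0 opprD addrA xw.
  apply: (le_trans (ler_distD (f x') _ _)); apply: lerD => //.
  by rewrite distrC.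
apply: (le_trans dec); apply: le_trans (_ : N * (c * r) + eta * (6 * H * r)
  + eta * (H * (4 * r)) + 8 * (m%:R * K) * eta * r
  + M * (8 * (m%:R * K) * eta * r) + M * (c * r) <= _).
  by rewrite !lerD.
by lra.
Qed.

(** * Exceptional points and the porosity of the pieces *)

(* Witness that x is exceptional: [sp_vec] spans V, [sp_coord] are the
   coordinates of the projection onto V along W, so that W is the range of
   z |-> z - \sum_i sp_coord i z *: sp_vec i, and [sp_lin] is the only candidate
   for the derivative at x. *)
Record splitting {R : realType} {X Y : normedModType R} (f : X -> Y) (x : X)
    (m : nat) := Splitting {
  sp_vec : 'I_m -> X;
  sp_coord : 'I_m -> {linear X -> R^o};
  sp_lin : {linear X -> Y};
  sp_coord_bound : R;
  sp_lin_bound : R;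
  sp_vec_bound : R;
  sp_eps : R;
  sp_coord_bound_ge0 : 0 <= sp_coord_bound;
  sp_lin_bound_ge0 : 0 <= sp_lin_bound;
  sp_vec_bound_ge0 : 0 <= sp_vec_bound;
  sp_eps_gt0 : 0 < sp_eps;
  sp_coord_le : forall i z, `|sp_coord i z| <= sp_coord_bound * `|z|;
  sp_lin_le : forall z, `|sp_lin z| <= sp_lin_bound * `|z|;
  sp_vec_le : forall i, `|sp_vec i| <= sp_vec_bound;
  sp_approx_span : forall eta, 0 < eta -> exists2 d, 0 < d &
    approx_on f x sp_lin
      (range (fun c : 'I_m -> R => \sum_i c i *: sp_vec i)) eta d;
  sp_approx_compl : forall eta, 0 < eta -> exists2 d, 0 < d &
    approx_on f x sp_lin
      (range (fun z => z - \sum_i sp_coord i z *: sp_vec i)) eta d;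
  sp_nondiff : forall d, 0 < d -> ~ approx_on f x sp_lin setT sp_eps d }.

(* [s] and [t] encode the approximate vectors and derivatives, [j] the
   accuracy [eta], [p] and [n] the radii of validity of the estimates.  The first two
   conditions say that [eta] is small relative to the constants of [S]. *)
Definition piece {R : realType} {X Y : normedModType R} (f : X -> Y)
    (sX : nat -> X) (sY : nat -> Y) (m n j p : nat) (s t : seq nat) : set X :=
  [set x | exists S : splitting f x m,
    let eta := j.+1%:R^-1 in
    let H := 1 + m%:R * sp_coord_bound S * sp_vec_bound S in
    [/\ [/\ m%:R * (sp_coord_bound S * (2 * eta)) <= 2^-1 &
        eta * (10 * H + 8 * (m%:R * sp_coord_bound S) +
          8 * (m%:R * sp_coord_bound S * sp_lin_bound S))
          <= sp_eps S / 2],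
      forall i, `|sp_vec S i - sX (nth 0%N s i)| <= eta,
      forall i, `|sp_lin S (sp_vec S i) - sY (nth 0%N t i)| <= eta,
      approx_on f x (sp_lin S)
        (range (fun c : 'I_m -> R => \sum_i c i *: sp_vec S i))
        eta p.+1%:R^-1 &
      forall h, `|h| < n.+1%:R^-1 -> `|f (x + h) - f x| <= n.+1%:R * `|h| ]].

Lemma piece_porous (R : realType) (X Y : completeNormedModType R) (f : X -> Y)
    (sX : nat -> X) (sY : nat -> Y) m n j p s t :
  porous (piece f sX sY m n j p s t).
Proof.
move=> x [[e a L K M E eps K0 M0 E0 eps0 aK LM eE Dspan Dcompl ndiff]] /=.
set eta := j.+1%:R^-1; set H := 1 + _; set T := _ + _ + _.
move=> [[small1 small2] esX bsY _ _].
have eta0 : 0 < eta by rewrite invr_gt0 ltr0n.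
pose N : R := n.+1%:R.
have N0 : 0 <= N by rewrite ler0n.
have H1 : 1 <= H by rewrite lerDl !mulr_ge0.
have den0 : 0 < 2 * (N + M) + eps by rewrite ltr_wpDl // mulr_ge0 // addr_ge0.
(* Makes (N + M) c <= eps / 2, the other half of eps being left to the eta term; the extra eps in
   the denominator gives c <= 1. *)
pose c := eps / (2 * (N + M) + eps).
have c0 : 0 < c by rewrite divr_gt0.
have c1 : c <= 1 by rewrite ler_pdivrMr // mul1r lerDr mulr_ge0 // addr_ge0.
have NMc : (N + M) * c <= eps / 2.
  rewrite /c mulrCA ler_wpM2l ?(ltW eps0) // ler_pdivrMr //.
  by have := ltW eps0; lra.
have [dW dW0 hW] := Dcompl eta eta0.
exists c => // d d0.
(* Besides d, these are the radii for the Lipschitz bound, for the span at any x' of the piece, and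
   for the complement at x. *)
pose d' :=
  Num.min (Num.min d N^-1) (Num.min (p.+1%:R^-1 / (6 * H)) (dW / (4 * H))).
have H0 : 0 < H by rewrite (lt_le_trans _ H1).
have d'0 : 0 < d'.
  by rewrite !lt_min d0 invr_gt0 ltr0n /= !divr_gt0 ?mulr_gt0 // invr_gt0 ltr0n.
have := ndiff d' d'0.
move=> /existsNP[h /not_implyP[_ /not_implyP[hd /negP]]].
rewrite -ltNge => far.
have h0 : 0 < `|h|.
  rewrite normr_gt0; apply/eqP => h0; move: far.
  by rewrite h0 addr0 subrr (linear0 L) subr0 !normr0 mulr0 ltxx.
move: hd; rewrite !lt_min => /andP[/andP[hd1 hd2] /andP[hd3 hd4]].
(* The hole is centred at a point where approximation by L fails; a point x' of the piece inside it
   would force the approximation to hold. *)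
exists (x + h); split.
- by rewrite -ball_normE /= opprD addNKr normrN.
- by rewrite -subr_eq0 addrC addKr -normr_gt0.
rewrite (addrAC x h) subrr add0r; apply/seteqP; split => // x' [].
rewrite -ball_normE /= => x'near.
case=> -[e' a' L' K' M' E' eps' K0' M0' E0' eps0' aK' LM' eE'].
move=> Dspan' Dcompl' ndiff'.
rewrite /= -/eta => -[_ esX' bsY' hV hL].
suff : `|f (h + x) - f x - L h| <= eps * `|h|.
  by rewrite (addrC h) leNgt far.
apply: (@le_trans _ _ (((N + M) * c + eta * T) * `|h|)); last first.
  rewrite ler_wpM2r //; lra.
have {2}-> : h = (h + x) - x by rewrite addrK.
apply: (@increment_estimate _ _ _ f m x x' (h + x) e e' a L L' K M E N c eta
  p.+1%:R^-1 dW N^-1 `|h|) => //.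
- by rewrite (ltW c0).
- move=> i; have := ler_distD (sX (nth 0%N s i)) (e' i) (e i).
  have := esX' i; have := esX i; rewrite (distrC (e i) (sX _)); lra.
- move=> i; have := ler_distD (sY (nth 0%N t i)) (L' (e' i)) (L (e i)).
  have := bsY' i; have := bsY i; rewrite (distrC (L (e i)) (sY _)); lra.
- by move=> z hz; have := hL _ hz; rewrite (addrC x') subrK.
- by rewrite addrK.
- by rewrite (addrC h) ltW.
- by move: hd3; rewrite ltr_pdivlMr ?mulr_gt0 // mulrC.
- by move: hd4; rewrite ltr_pdivlMr ?mulr_gt0 // mulrC.
Qed.

(** * Countably many parameters: each exceptional point lies in a piece *)

Lemma ex_lt_natS (R : realType) (x : R) : exists n, x < n.+1%:R.
Proof.
exists (Num.bound `|x|); apply: (le_lt_trans (ler_norm x)).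
by apply: (lt_le_trans (archi_boundP (normr_ge0 x))); rewrite ler_nat.
Qed.

Lemma ex_invS_lt (R : realType) (x : R) : 0 < x -> exists n, n.+1%:R^-1 < x.
Proof.
move=> x0; have [n hn] := ex_lt_natS x^-1; exists n.
by rewrite -[ltRHS]invrK ltf_pV2 // ?posrE ?invr_gt0.
Qed.

Lemma dense_sequence (R : realType) (X : normedModType R) :
  separable X -> exists s : nat -> X,
    forall (x : X) (e : R), 0 < e -> exists k, `|x - s k| < e.
Proof.
move=> [D [Dc Dd]].
have [s sD] : exists s : nat -> X, set_surj setT D s.
  exact/pcard_surjP.
exists s => x e e0.
have [|y [xy Dy]] := Dd (ball x e) _ (ball_open _ _).
  by exists x; exact: ballxx.
have [k _ ky] := sD y Dy.
by exists k; rewrite ky; move: xy; rewrite -ball_normE.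
Qed.

Lemma lipschitz_at_bound (R : realType) (X Y : normedModType R) (f : X -> Y) x :
  lipschitz_at f x -> exists n : nat, forall h,
    `|h| < n.+1%:R^-1 -> `|f (x + h) - f x| <= n.+1%:R * `|h|.
Proof.
rewrite /lipschitz_at /limf_esup => /ereal_inf_lt[_ [S xS <-]] supS.
have [M0 hM0] : exists M : R, forall y, S y -> `|f y - f x| / `|y - x| <= M.
  case E : (ereal_sup _) supS => [M| |] // _.
    exists M => y Sy; rewrite -lee_fin -E.
    by apply: ereal_sup_ubound; exists y.
  (* A supremum -oo means that [S] is empty, so any bound will do. *)
  exists 0 => y Sy; have : ((`|f y - f x| / `|y - x|)%:E <= -oo)%E.
    by rewrite -E; apply: ereal_sup_ubound; exists y.
  by [].
have [d /= d0 hd] : exists2 d : R, 0 < d &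
    forall y, ball x d y -> y != x -> S y.
  move: xS; rewrite /dnbhs /within /= => /nbhs_ballP[d d0 hd].
  by exists d.
have [n1 hn1] := ex_lt_natS M0.
have [n2 hn2] := ex_invS_lt d0.
(* One integer serves both as Lipschitz constant and as inverse radius. *)
exists (maxn n1 n2) => h hh.
have [->|h0] := eqVneq h 0; first by rewrite addr0 subrr !normr0 mulr0.
have Sy : S (x + h).
  apply: hd; last by rewrite -subr_eq0 (addrAC x h) subrr add0r.
  rewrite -ball_normE /= opprD addNKr normrN (lt_trans hh) //.
  rewrite (le_lt_trans _ hn2) // lef_pV2 ?posrE ?ltr0n //.
  by rewrite ler_nat ltnS leq_maxr.
have := hM0 _ Sy; rewrite (addrAC x h) subrr add0r ler_pdivrMr ?normr_gt0 //.
move=> /le_trans; apply; rewrite ler_wpM2r // (le_trans (ltW hn1)) //.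
by rewrite ler_nat ltnS leq_maxl.
Qed.

(** Indices are kept in a list so that the pieces for all [m] share one countable index type. The
    list built here has length m, so the default of [nth] is not reached. *)
Lemma approx_seq (R : realType) (Z : normedModType R) (sZ : nat -> Z)
    (sZ_dense : forall z (e : R), 0 < e -> exists k, `|z - sZ k| < e)
    (m : nat) (v : 'I_m -> Z) (e : R) : 0 < e ->
  exists s : seq nat, forall i, `|v i - sZ (nth 0%N s i)| <= e.
Proof.
move=> e0; have [g hg] := choice (fun i : 'I_m => sZ_dense (v i) e e0).
exists (map g (enum 'I_m)) => i.
by rewrite (nth_map i) ?size_enum_ord // nth_ord_enum ltW.
Qed.

Lemma splitting_in_piece (R : realType) (X Y : normedModType R) (f : X -> Y)
    (sX : nat -> X) (sY : nat -> Y)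
    (sX_dense : forall x (e : R), 0 < e -> exists k, `|x - sX k| < e)
    (sY_dense : forall y (e : R), 0 < e -> exists k, `|y - sY k| < e)
    (x : X) (m : nat) :
  lipschitz_at f x -> splitting f x m ->
  exists n j p s t, piece f sX sY m n j p s t x.
Proof.
move=> /lipschitz_at_bound[n hn] S.
set H := 1 + m%:R * sp_coord_bound S * sp_vec_bound S.
(* [A] and [B] are the lower bounds on 1/eta equivalent to the two smallness conditions of [piece].
   The radius index p is chosen last, as it depends on eta. *)
pose A := m%:R * sp_coord_bound S * 4.
pose B := (10 * H + 8 * (m%:R * sp_coord_bound S) +
          8 * (m%:R * sp_coord_bound S * sp_lin_bound S)) / (sp_eps S / 2).
have [j hj] := ex_lt_natS (Num.max A B).
move: hj; rewrite gt_max => /andP[hA hB].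
have eps0 := sp_eps_gt0 S.
set eta : R := j.+1%:R^-1.
have eta0 : 0 < eta by rewrite invr_gt0 ltr0n.
have [s hs] := approx_seq sX_dense (sp_vec S) eta0.
have [t ht] := approx_seq sY_dense (fun i => sp_lin S (sp_vec S i)) eta0.
have [d d0 hd] := sp_approx_span S eta0.
have [p hp] := ex_invS_lt d0.
exists n, j, p, s, t, S; split => //.
- split.
  + have : A * eta <= 1 by rewrite /eta ler_pdivrMr ?ltr0n // mul1r ltW.
    by rewrite /A -/eta; lra.
  + rewrite /eta mulrC ler_pdivrMr ?ltr0n // (mulrC (_ / 2)).
    by move: hB; rewrite /B ltr_pdivrMr ?divr_gt0 // => /ltW.
- by move=> h hS hh; apply: hd => //; apply: lt_trans hp.
Qed.

(** * Partial derivatives, coordinates and projections *)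

Lemma coord_le_mx_norm (R : realType) (m : nat) (c : 'rV[R]_m) i :
  `|c 0 i| <= `|c|.
Proof.
rewrite [leRHS]/Num.norm /= mx_normrE.
exact: (le_bigmax _ (fun ij => `|c ij.1 ij.2|) (0, i)).
Qed.

Lemma differentiable_alongP (R : realType) (X Y : normedModType R) (f : X -> Y)
    (x : X) (V : submodClosed X) :
  differentiable_along f x V ->
  exists B : {linear subsp V -> Y}, continuous B /\
    forall eta, 0 < eta -> exists2 d, 0 < d &
      forall v : subsp V, `|\val v| < d ->
        `|f (x + \val v) - f x - B v| <= eta * `|\val v|.
Proof.
move=> /diff_locallyP[Bc]; set B : {linear subsp V -> Y} := 'd _ _.
move=> /eqaddoP hB; exists B; split => // eta eta0.
have /nbhs_norm0P[d d0 hd] := hB _ eta0.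
exists d => // v vd; have := hd v vd.
by rewrite /= !fctE /= !addr0 opprD addrA.
Qed.

Lemma differentiable_of_approx (R : realType) (X Y : normedModType R)
    (f : X -> Y) (x : X) (L : {linear X -> Y}) : continuous L ->
  (forall eta, 0 < eta -> exists2 d, 0 < d & approx_on f x L setT eta d) ->
  differentiable f x.
Proof.
move=> Lc hL.
have e : f \o shift x = cst (f x) + L +o_ 0 id.
  apply/eqaddoP => eta eta0; have [d d0 hd] := hL eta eta0.
  apply/nbhs_norm0P; exists d => // h hh.
  by rewrite /= !fctE /= opprD addrA (addrC h); apply: hd.
by apply/diff_locallyP; rewrite (diff_unique Lc e).
Qed.

(** The norm of \sum_i c_i e_i is continuous and nonzero on the compact unit sphere, so it stays
    away from 0 there; homogeneity does the rest. Arguing with the closed image instead of a minimum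
    covers m = 0, where the sphere is empty. *)
Lemma linear_independent_bound (R : realType) (X : normedModType R) (m : nat)
    (e : 'I_m -> X) :
  (forall c : 'I_m -> R, \sum_i c i *: e i = 0 -> forall i, c i = 0) ->
  exists2 K : R, 0 <= K &
    forall (c : 'I_m -> R) i, `|c i| <= K * `|\sum_i c i *: e i|.
Proof.
move=> free.
pose g (c : 'rV[R]_m) := `|\sum_i c 0 i *: e i|.
have sc : continuous (fun c : 'rV[R]_m => \sum_i c 0 i *: e i).
  apply: continuous_big => [|i _ c]; first exact: add_continuous.
  exact: (@cvgZr_tmp _ _ _ (nbhs c) (nbhs_filter c) _ _ (e i)
    (@coord_continuous R 1 m 0 i c)).
have gc : continuous g.
  by move=> c; exact: (cvg_comp _ _ (sc c) (@norm_continuous _ X _)).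
pose S := [set c : 'rV[R]_m | `|c| = 1].
have Sc : compact S.
  apply: bounded_closed_compact.
    by exists 1; split => // k k1 c /= ->; apply: ltW.
  have -> : S = (Num.norm : 'rV[R]_m -> R) @^-1` [set x | x = 1] by [].
  apply: closed_comp; last exact: closed_eq.
  by move=> c _; exact: norm_continuous.
have gSc : closed (g @` S).
  apply: compact_closed; first exact: Rhausdorff.
  by apply: continuous_compact Sc; exact: continuous_subspaceT.
have g0 : (~` (g @` S)) 0.
  move=> [c c1 /eqP]; rewrite normr_eq0 => /eqP /free c0.
  have : c = 0 by apply/rowP => i; rewrite c0 mxE.
  move=> c0'; move: c1; rewrite /S /= c0' normr0 => /esym /eqP.
  by rewrite oner_eq0.
have /nbhs_norm0P[mu mu0 hmu] : nbhs 0 (~` (g @` S)).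
  by apply: open_nbhs_nbhs; split => //; exact: closed_openC.
exists mu^-1; first by rewrite invr_ge0 ltW.
move=> c i.
pose r : 'rV[R]_m := \row_i c i.
have -> : c i = r 0 i by rewrite mxE.
apply: (le_trans (coord_le_mx_norm _ _)).
have -> : `|\sum_i c i *: e i| = g r.
  by rewrite /g; congr (`| _ |); apply: eq_bigr => k _; rewrite mxE.
have [->|r0] := eqVneq r 0.
  by rewrite normr0 mulr_ge0 ?invr_ge0 ?(ltW mu0) // /g normr_ge0.
rewrite mulrC ler_pdivlMr //.
have rn0 : 0 < `|r| by rewrite normr_gt0.
(* Otherwise normalizing r gives a value on the sphere within mu of 0. *)
rewrite leNgt; apply/negP => lt.
apply: (hmu (g (`|r|^-1 *: r))); last first.
  exists (`|r|^-1 *: r) => //=.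
  by rewrite /S /= normrZ normfV normr_id mulVf ?gt_eqF.
have -> : g (`|r|^-1 *: r) = `|r|^-1 * g r.
  rewrite /g -[X in X * _](@ger0_norm _ `|r|^-1) ?invr_ge0 // -normrZ.
  rewrite scaler_sumr.
  by congr (`| _ |); apply: eq_bigr => k _; rewrite mxE scalerA.
rewrite /= ger0_norm; last by rewrite mulr_ge0 ?invr_ge0 // /g normr_ge0.
by rewrite mulrC ltr_pdivrMr // mulrC.
Qed.

(** A spanning family of minimal length is linearly independent, so coordinates are unique, hence
    linear, and bounded by the previous lemma. *)
Lemma finite_dimensional_coordinates (R : realType) (X : normedModType R)
    (V : submodClosed X) : finite_dimensional V ->
  exists m (e : 'I_m -> X) (b : 'I_m -> {linear subsp V -> R^o}) (K : R),
    [/\ 0 <= K, forall i, e i \in V,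
        forall v : subsp V, \val v = \sum_i b i v *: e i &
        forall i (v : subsp V), `|b i v| <= K * `|\val v|].
Proof.
pose spans n := exists e : 'I_n -> X, (forall i, e i \in V) /\
    forall v, v \in V -> exists a : 'I_n -> R, v = \sum_(i < n) a i *: e i.
move=> Vfin; have {}Vfin : exists n, `[< spans n >].
  by have [n hn] := Vfin; exists n; apply/asboolP.
case: (ex_minnP Vfin) => n /asboolP[e [eV espan]] nmin.
have free : forall c : 'I_n -> R, \sum_i c i *: e i = 0 -> forall i, c i = 0.
  case: n e eV espan nmin => [|n] e eV espan nmin c c0 i; first by case: i.
  apply/eqP/negPn/negP => ci.
  have := nmin n; rewrite ltnn => /implyP; rewrite implybF => /negP; apply.
  apply/asboolP; exists (fun j => e (lift i j)); split => // v vV.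
  have [a ->] := espan v vV.
  (* Coefficients after eliminating e_i by means of the relation c, in which c_i is nonzero. *)
  exists (fun j => a (lift i j) - a i * (c i)^-1 * c (lift i j)).
  have ei : e i = - ((c i)^-1 *: \sum_j c (lift i j) *: e (lift i j)).
    move: c0; rewrite (bigD1_ord i) //= => /eqP; rewrite addr_eq0 => /eqP h.
    by rewrite -scalerN -h scalerA mulVf // scale1r.
  rewrite (bigD1_ord i) //= {1}ei scalerN scalerA scaler_sumr addrC -sumrB.
  by apply: eq_bigr => j _; rewrite scalerBl !scalerA.
have [K K0 hK] := linear_independent_bound free.
have [b hb] := choice (fun v : subsp V => espan (\val v) (valP v)).
have uniq (c c' : 'I_n -> R) :
    \sum_i c i *: e i = \sum_i c' i *: e i -> c =1 c'.
  move=> cc' i; apply/eqP; rewrite -subr_eq0; apply/eqP.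
  apply: (free (fun i => c i - c' i)).
  by under eq_bigr do rewrite scalerBl; rewrite sumrB cc' subrr.
have blin i : linear (fun v => b v i : R^o).
  move=> k u v; apply: (uniq (b (k *: u + v)) (fun i => k * b u i + b v i)).
  under [RHS]eq_bigr do rewrite scalerDl -scalerA.
  by rewrite big_split /= -scaler_sumr -!hb.
pose bL i : {linear subsp V -> R^o} :=
  HB.pack (fun v => b v i : R^o) (GRing.isLinear.Build _ _ _ _ _ (blin i)).
exists n, e, bL, K; split => // i v.
by rewrite /= (hb v).
Qed.

(** The inverse of the addition map is linear because addition is, and bounded because it is
    continuous. The product carries the max norm, so one constant serves both components. *)
Lemma topological_direct_sum_projections (R : realType) (X : normedModType R)
    (V W : submodClosed X) : topological_direct_sum V W ->
  exists (P : {linear X -> subsp V}) (Q : {linear X -> subsp W}) (k : R),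
    [/\ 0 <= k, forall u, u = \val (P u) + \val (Q u),
        forall v : subsp V, P (\val v) = v /\ Q (\val v) = 0,
        forall w : subsp W, P (\val w) = 0 /\ Q (\val w) = w &
        forall u, `|P u| <= k * `|u| /\ `|Q u| <= k * `|u|].
Proof.
move=> [_ [h [addK hK hc]]].
have hlin : linear h.
  move=> c u v; rewrite -[RHS]addK; congr h.
  rewrite -[in LHS](hK u) -[in LHS](hK v) /subsp_add.
  case: (h u) (h v) => [u1 u2] [v1 v2].
  transitivity ((c *: \val u1 + \val v1) + (c *: \val u2 + \val v2)).
    by rewrite /= scalerDr addrACA.
  by congr (_ + _).
pose hL : {linear X -> (subsp V * subsp W)%type} :=
  HB.pack h (GRing.isLinear.Build _ _ _ _ _ hlin).
have [k k0 hk] := linear_lipschitz (f := hL) hc.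
have Plin : linear (fun u => (h u).1) by move=> c u v; rewrite hlin.
have Qlin : linear (fun u => (h u).2) by move=> c u v; rewrite hlin.
pose P : {linear X -> subsp V} :=
  HB.pack (fun u => (h u).1) (GRing.isLinear.Build _ _ _ _ _ Plin).
pose Q : {linear X -> subsp W} :=
  HB.pack (fun u => (h u).2) (GRing.isLinear.Build _ _ _ _ _ Qlin).
exists P, Q, k; split => /=.
- exact: ltW.
- by move=> u; rewrite -[LHS]hK.
- move=> v; have -> : h (\val v) = (v, 0); last by [].
  by rewrite -[RHS]addK /subsp_add /= addr0.
- move=> w; have -> : h (\val w) = (0, w); last by [].
  by rewrite -[RHS]addK /subsp_add /= add0r.
- move=> u; have := hk u; rewrite /= prod_normE ge_max => /andP[].
  by [].
Qed.

(** The candidate derivative is L = B P + A Q, and the coordinates are those of P z. Then z - \sum_i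
    a_i(z) e_i = Q z, which turns differentiability along W into the estimate on the complement. *)
Lemma splitting_of_partial_differentiability (R : realType)
    (X Y : normedModType R) (f : X -> Y) (x : X) (V W : submodClosed X) :
  finite_dimensional V -> topological_direct_sum V W ->
  differentiable_along f x V -> differentiable_along f x W ->
  ~ differentiable f x -> exists m, inhabited (splitting f x m).
Proof.
move=> Vfin VW /differentiable_alongP[B [Bc fB]].
move=> /differentiable_alongP[A [Ac fA]] ndiff.
have [P [Q [k [k0 PQ PQV PQW PQk]]]] := topological_direct_sum_projections VW.
have [m [e [b [K [K0 eV be bK]]]]] := finite_dimensional_coordinates Vfin.
have [kA kA0 AkA] := linear_lipschitz Ac.
have [kB kB0 BkB] := linear_lipschitz Bc.
have Llin : linear (fun u => B (P u) + A (Q u)).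
  by move=> c u v; rewrite !linearP scalerDr addrACA.
pose L : {linear X -> Y} :=
  HB.pack (fun u => B (P u) + A (Q u)) (GRing.isLinear.Build _ _ _ _ _ Llin).
have alin i : linear (fun u => b i (P u) : R^o).
  by move=> c u v; rewrite !linearP.
pose a i : {linear X -> R^o} :=
  HB.pack (fun u => b i (P u) : R^o) (GRing.isLinear.Build _ _ _ _ _ (alin i)).
have LM z : `|L z| <= (kB * k + kA * k) * `|z|.
  have [Pk Qk] := PQk z.
  rewrite mulrDl -!mulrA; apply: (le_trans (ler_normD _ _)); apply: lerD.
    by apply: (le_trans (BkB _)); rewrite ler_wpM2l // ltW.
  by apply: (le_trans (AkA _)); rewrite ler_wpM2l // ltW.
have M0 : 0 <= kB * k + kA * k by rewrite addr_ge0 ?mulr_ge0 // ltW.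
have Lc : continuous L.
  apply: bounded_linear_continuous; apply/linear_boundedP.
  exists (kB * k + kA * k); split; first exact: num_real.
  by move=> r Mr z; apply: (le_trans (LM z)); rewrite ler_wpM2r // ltW.
(* If no eps worked, L would be the Fréchet derivative at x. *)
have [eps [eps0 far]] : exists eps, 0 < eps /\
    forall d, 0 < d -> ~ approx_on f x L setT eps d.
  apply: contra_notP ndiff => /forallNP near.
  apply: (differentiable_of_approx Lc) => eta eta0.
  have := near eta => /not_andP[//|/existsNP[d /not_implyP[d0 /contrapT hd]]].
  by exists d.
exists m; constructor.
apply: (@Splitting _ _ _ f x m e a L (K * k) (kB * k + kA * k)
  (\sum_i `|e i|) eps).
- exact: mulr_ge0.
- exact: M0.
- by rewrite sumr_ge0.
- exact: eps0.
- move=> i z /=; rewrite -mulrA; apply: (le_trans (bK _ _)).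
  by rewrite ler_wpM2l //; case: (PQk z).
- exact: LM.
- by move=> i; rewrite (bigD1 i) //= lerDl sumr_ge0.
- move=> eta eta0; have [d d0 hd] := fB eta eta0.
  exists d => // _ [c _ <-] hh.
  have uV : \sum_i c i *: e i \in V.
    by rewrite rpred_sum // => i _; rewrite rpredZ.
  pose v : subsp V := exist (fun u : X => u \in V) _ uV.
  have [Pv Qv] := PQV v.
  have -> : L (\sum_i c i *: e i) = B v.
    by rewrite -[\sum_i c i *: e i]/(\val v) /= Pv Qv linear0 addr0.
  exact: (hd v hh).
- move=> eta eta0; have [d d0 hd] := fA eta eta0.
  exists d => // _ [z _ <-].
  have -> : z - \sum_i a i z *: e i = \val (Q z).
    by rewrite /= -be {1}(PQ z) addrC addKr.
  move=> hh; have := hd (Q z) hh.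
  have [Pw Qw] := PQW (Q z).
  have -> : L (\val (Q z)) = A (Q z) by rewrite /= Pw Qw linear0 add0r.
  by [].
- exact: far.
Qed.

(** * The exceptional set as a countable union of pieces *)

Unset Implicit Arguments.

Theorem corollary5p6 (R : realType) (X Y : completeNormedModType R)
    (X_neq0 : exists x : X, x != 0) (Y_neq0 : exists y : Y, y != 0)
    (X_sep : separable X) (Y_sep : separable Y)
    (G : set X) (G_open : open G) (f : X -> Y) :
  exists A : set X, [/\ sigma_porous A, A `<=` G &
    forall x, (G `\` A) x ->
      lipschitz_at f x ->
      (exists V W : submodClosed X,
        [/\ banach_subspace V, finite_dimensional V,
            topological_complement V W,
            differentiable_along f x V & differentiable_along f x W]) ->
      differentiable f x].
Proof.
have [sX sX_dense] := dense_sequence X_sep.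
have [sY sY_dense] := dense_sequence Y_sep.
pose P (i : nat * nat * nat * nat * seq nat * seq nat) : set X :=
  let: (m, n, j, p, s, t) := i in piece f sX sY m n j p s t `&` G.
(* Parameter tuples are enumerated by their codes; a number coding no tuple gives the empty set,
   which is porous. *)
pose Q k : set X := if unpickle k is Some i then P i else set0.
exists (\bigcup_k Q k); split.
- exists Q; split => // k; rewrite /Q; case: unpickle => [|//].
  move=> [[[[[m n] j] p] s] t] x [/piece_porous[c c0 hc] _].
  (* Holes of a piece are also holes of its part inside [G]. *)
  exists c => // d d0; have [u [xu ux hu]] := hc d d0; exists u; split => //.
  by rewrite -subset0 -hu setIA; exact: subIsetl.
- move=> x [k _]; rewrite /Q; case: unpickle => [|//].
  by move=> [[[[[m n] j] p] s] t] [].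
- move=> x [Gx nQ] lip [V [W [_ Vfin [_ VW] dV dW]]].
  apply: contrapT => /(splitting_of_partial_differentiability Vfin VW dV dW).
  move=> [m [S]].
  have [n [j [p [s [t hx]]]]] := splitting_in_piece sX_dense sY_dense lip S.
  by apply: nQ; exists (pickle (m, n, j, p, s, t)); rewrite /Q ?pickleK.
Qed.
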